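(* Let $p$ be an odd prime and let \[ L_p=\langle x_i\ (i\in\mathbb N),\ y_{i,k}\ (i<k)\mid x_i^p,\ [x_i,x_k]y_{i,k}^{-1}\ (i<k),\ [y_{i,k},x_r]\ (i<k,\ r\in\mathbb N)\rangle, \] the free nilpotent-of-class-$2$ group of exponent $p$ on countably infinitely many generators. Then $L_p$ is not word automatic.
   Context: A group $G$ is word automatic (FA-presentable) if there are a finite alphabet $\Sigma$, a regular set $D\subseteq\Sigma^*$ and a bijection $D\to G$ such that, with respect to the induced operation $\circ$ on $D$, the relation $\{(u,v,w)\in D^3: u\circ v=w\}$ is recognized by a synchronous finite automaton reading the three strings in parallel (shorter strings padded with a blank symbol). *)

(* Defs.v *)
From HB Require Import structures.
From mathcomp Require Import all_boot.
From mathcomp Require Import boolp classical_sets functions.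

Set Implicit Arguments.
Unset Strict Implicit.
Unset Printing Implicit Defensive.

Local Open Scope classical_set_scope.
Local Open Scope quotient_scope.

Record dfa (S : finType) := Dfa {
  dfa_state : finType;
  dfa_start : dfa_state;
  dfa_final : pred dfa_state;
  dfa_step : dfa_state -> S -> dfa_state }.

Definition dfa_accept (S : finType) (A : dfa S) (u : seq S) : bool :=
  @dfa_final S A (foldl (@dfa_step S A) (@dfa_start S A) u).

Definition regular (S : finType) (D : set (seq S)) : Prop :=
  exists A : dfa S, forall u, D u <-> dfa_accept A u.

(** The blank symbol is [None]; it only occurs at the end of a track. *)
Definition pad (S : Type) (n : nat) (u : seq S) : seq (option S) :=
  map Some u ++ nseq (n - size u) None.

Definition conv3 (S : Type) (u v w : seq S) :
    seq (option S * option S * option S) :=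
  let n := maxn (size u) (maxn (size v) (size w)) in
  zip (zip (pad n u) (pad n v)) (pad n w).

Definition automatic_rel3 (S : finType)
    (Rel : seq S -> seq S -> seq S -> Prop) : Prop :=
  exists A : dfa (option S * option S * option S)%type,
    forall u v w, Rel u v w <-> dfa_accept A (conv3 u v w).

(** [f] is total on strings, but only its restriction to [D] matters. *)
Definition word_automatic (G : groupType) : Prop :=
  exists (S : finType) (D : set (seq S)) (f : seq S -> G),
    [/\ regular D,
        set_bij D [set: G] f &
        automatic_rel3 (fun u v w =>
          [/\ D u, D v, D w & (f u * f v)%g = f w])].

(** [(t, false)] stands for the generator [t] and [(t, true)] for its
    formal inverse. *)
Definition word (T : Type) := seq (T * bool).

Definition inv_letter (T : Type) (a : T * bool) : T * bool := (a.1, ~~ a.2).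

Definition inv_word (T : Type) (u : word T) : word T :=
  rev (map (@inv_letter T) u).

(** [u^-1 v^-1 u v], the convention of [commg]. *)
Definition comm_word (T : Type) (u v : word T) : word T :=
  inv_word u ++ inv_word v ++ u ++ v.

Inductive pres_eq (T : Type) (R : set (word T)) : word T -> word T -> Prop :=
| pres_refl u : pres_eq R u u
| pres_sym u v : pres_eq R u v -> pres_eq R v u
| pres_trans v u w : pres_eq R u v -> pres_eq R v w -> pres_eq R u w
| pres_cat u u' v v' :
    pres_eq R u u' -> pres_eq R v v' -> pres_eq R (u ++ v) (u' ++ v')
| pres_cancel a : pres_eq R [:: a; inv_letter a] [::]
| pres_rel r : R r -> pres_eq R r [::].

Section Presented.
Variables (T : choiceType) (R : set (word T)).

Definition pres_eqb (u v : word T) : bool := `[< pres_eq R u v >].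

Fact pres_eqb_refl : reflexive pres_eqb.
Proof. by move=> u; apply/asboolP/pres_refl. Qed.

Fact pres_eqb_sym : symmetric pres_eqb.
Proof. by move=> u v; apply/asboolP/asboolP; apply: pres_sym. Qed.

Fact pres_eqb_trans : transitive pres_eqb.
Proof.
move=> v u w /asboolP uv /asboolP vw.
by apply/asboolP; apply: pres_trans uv vw.
Qed.

Canonical pres_equiv :=
  EquivRel pres_eqb pres_eqb_refl pres_eqb_sym pres_eqb_trans.

Definition presented := {eq_quot pres_equiv}.

HB.instance Definition _ := Choice.on presented.
HB.instance Definition _ := EqQuotient.on presented.

Lemma presentedP (u v : word T) :
  \pi_presented u = \pi_presented v <-> pres_eq R u v.
Proof. by split=> [/eqmodP/asboolP|uv] //; apply/eqmodP/asboolP. Qed.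

Lemma pres_repr (u : word T) : pres_eq R (repr (\pi_presented u)) u.
Proof. by apply/presentedP; rewrite reprK. Qed.

Lemma pres_mulV (u : word T) : pres_eq R (u ++ inv_word u) [::].
Proof.
rewrite /inv_word; elim: u => [|a u IH] /=; first exact: pres_refl.
rewrite rev_cons -cats1 catA; apply: pres_trans (pres_cancel R a).
apply: (pres_cat (pres_refl R [:: a])).
exact: (pres_cat IH (pres_refl R [:: inv_letter a])).
Qed.

Lemma inv_wordK : involutive (@inv_word T).
Proof.
move=> u; rewrite /inv_word map_rev revK -map_comp -[RHS]map_id.
by apply: eq_map => -[t b]; rewrite /inv_letter /= negbK.
Qed.

Lemma pres_Vmul (u : word T) : pres_eq R (inv_word u ++ u) [::].
Proof. by have := pres_mulV (inv_word u); rewrite inv_wordK. Qed.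

Lemma pres_inv (u v : word T) :
  pres_eq R u v -> pres_eq R (inv_word u) (inv_word v).
Proof.
move=> uv; rewrite -[inv_word u]cats0.
apply: pres_trans (pres_cat (pres_refl _ _) (pres_sym (pres_mulV v))) _.
rewrite catA -[X in pres_eq _ _ X]cat0s; apply: pres_cat (pres_refl _ _).
apply: pres_trans (pres_Vmul u).
exact: pres_cat (pres_refl _ _) (pres_sym uv).
Qed.

Definition pres_one := lift_cst presented [::].
Definition pres_mul := lift_op2 presented (@cat (T * bool)).
Definition pres_invg := lift_op1 presented (@inv_word T).

Canonical pi_pres_one_morph := PiConst pres_one.

Lemma pi_pres_mul :
  {morph \pi_presented : u v / u ++ v >-> pres_mul u v}.
Proof.
by move=> u v; unlock pres_mul; apply/presentedP/pres_cat; apply: pres_sym;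
   apply: pres_repr.
Qed.
Canonical pi_pres_mul_morph := PiMorph2 pi_pres_mul.

Lemma pi_pres_inv :
  {morph \pi_presented : u / inv_word u >-> pres_invg u}.
Proof.
by move=> u; unlock pres_invg; apply/presentedP/pres_inv/pres_sym/pres_repr.
Qed.
Canonical pi_pres_inv_morph := PiMorph1 pi_pres_inv.

Fact pres_mulA : associative pres_mul.
Proof.
by move=> x y z; rewrite -[x]reprK -[y]reprK -[z]reprK !piE catA.
Qed.

Fact pres_mul1g : left_id pres_one pres_mul.
Proof. by move=> x; rewrite -[x]reprK !piE. Qed.

Fact pres_mulg1 : right_id pres_one pres_mul.
Proof. by move=> x; rewrite -[x]reprK !piE cats0. Qed.

Fact pres_mulVg : left_inverse pres_one pres_invg pres_mul.
Proof.
by move=> x; rewrite -[x]reprK !piE; apply/presentedP/pres_Vmul.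
Qed.

Fact pres_mulgV : right_inverse pres_one pres_invg pres_mul.
Proof.
by move=> x; rewrite -[x]reprK !piE; apply/presentedP/pres_mulV.
Qed.

HB.instance Definition _ :=
  isGroup.Build presented pres_mulA pres_mul1g pres_mulg1 pres_mulVg pres_mulgV.

End Presented.

Definition L_gen := (nat + {ik : nat * nat | ik.1 < ik.2})%type.

Definition Lx (i : nat) : word L_gen := [:: (inl i, false)].

Definition Ly (i k : nat) (lt_ik : i < k) : word L_gen :=
  [:: (inr (exist (fun ik : nat * nat => ik.1 < ik.2) (i, k) lt_ik), false)].

Inductive L_relator (p : nat) : word L_gen -> Prop :=
| L_rel_exp i : L_relator p (flatten (nseq p (Lx i)))
| L_rel_comm i k (lt_ik : i < k) :
    L_relator p (comm_word (Lx i) (Lx k) ++ inv_word (Ly lt_ik))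
| L_rel_central i k (lt_ik : i < k) r :
    L_relator p (comm_word (Ly lt_ik) (Lx r)).

Definition L (p : nat) : groupType := presented (L_relator p).

(* Main.v *)
Require Import Defs.
From mathcomp Require Import all_boot.
From HB Require Import structures.
From mathcomp Require Import all_order ssralg zmodp.
From mathcomp Require Import zify ring.
From mathcomp Require Import boolp classical_sets functions.

(** Measure an element of an automatic group by the length of its string.
    Multiplication and inversion increase lengths by a bounded amount, and
    only exponentially many elements have length at most [n].

    Fix the generator [x_0]. A pumping argument shows that among the [g] with
    [g, x_0] longer than [n] there is one of length at most [n + K]. Choosing
    [n] larger than all commutators [s, x_0] with [s] a product of powers of
    the elements already selected, and clearing the pivots of the latter from
    [g] by right division by such an [s], one obtains elements
    [g_0, g_1, ...] of linearly growing length whose images in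
    [F_p^(N) = L_p / L_p'] are in echelon form.

    For d x d boolean matrices [a], the [2^(d^2)] elements
    [prod_k [prod_i g_i^(a_ik), g_(d+k)]] with [i, k < d] are pairwise distinct
    since the commutator induces an embedding of the exterior square of
    [L_p / L_p'] in the centre. When the products are evaluated factor by factor
    their length is [O(d)], so that [2^(d^2) <= 2^O(d)] for all [d]. *)

Set Implicit Arguments.
Unset Strict Implicit.
Unset Printing Implicit Defensive.

Import GRing.Theory.

(** * Pumping *)

Section Cut.
Variables (S : Type).

Definition cut (i j : nat) (s : seq S) : seq S := take i s ++ drop j s.

Lemma size_cut i j s :
  size (cut i j s) = minn i (size s) + (size s - j).
Proof. by rewrite size_cat size_take_min size_drop. Qed.

Lemma cut_id i j s : size s <= i -> i <= j -> cut i j s = s.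
Proof.
move=> si ij; rewrite /cut take_oversize // drop_oversize ?cats0 //.
exact: leq_trans si ij.
Qed.

Lemma onth_cut i j s k : i <= j ->
  onth (cut i j s) k = if k < i then onth s k else onth s (k - i + j).
Proof.
move=> ij; rewrite !onthE /cut map_cat nth_cat size_map size_take_min.
rewrite map_take map_drop nth_drop; case: (ltnP k i) => ki.
  case: (ltnP k (size s)) => ks; first by rewrite leq_min ki ks nth_take.
  rewrite ifF; last by lia.
  by rewrite !nth_default // size_map; lia.
rewrite ifF; last by lia.
case: (leqP i (size s)) => si.
  by congr (nth _ _ _); lia.
by rewrite !nth_default // size_map; lia.
Qed.

Lemma size_pad n (u : seq S) : size u <= n -> size (pad n u) = n.
Proof. by move=> un; rewrite size_cat size_map size_nseq; lia. Qed.

Lemma nth_pad n (u : seq S) k : nth None (pad n u) k = onth u k.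
Proof.
rewrite onthE /pad nth_cat size_map; case: ltnP => // uk.
by rewrite nth_nseq if_same nth_default // size_map.
Qed.

Lemma size_conv3 (u v w : seq S) :
  size (conv3 u v w) = maxn (size u) (maxn (size v) (size w)).
Proof. by rewrite !size_zip !size_pad; lia. Qed.

Lemma nth_conv3 (u v w : seq S) k :
  nth (None, None, None) (conv3 u v w) k = (onth u k, onth v k, onth w k).
Proof.
rewrite /conv3 nth_zip ?nth_zip ?nth_pad //.
  by rewrite !size_pad; lia.
by rewrite !size_zip !size_pad; lia.
Qed.

End Cut.

(** Padding occurs only past the end of a track, where [onth] gives [None], so both sides can be
    compared position by position. *)
Lemma conv3_cut (S : Type) i j (u v w : seq S) :
  i <= j -> j <= maxn (size u) (maxn (size v) (size w)) ->
  conv3 (cut i j u) (cut i j v) (cut i j w) = cut i j (conv3 u v w).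
Proof.
move=> ij jN; apply: (@eq_from_nth _ (None, None, None)) => [|k _].
  by rewrite size_cut !size_conv3 !size_cut; lia.
rewrite nth_conv3 !onth_cut // /cut nth_cat size_take_min size_conv3.
case: (ltnP k i) => ki; first by rewrite ifT ?nth_take ?nth_conv3 //; lia.
rewrite ifF; last by lia.
by rewrite nth_drop nth_conv3; congr (onth _ _, onth _ _, onth _ _); lia.
Qed.

Definition run (S : finType) (A : dfa S) (s : seq S) : dfa_state A :=
  foldl (@dfa_step S A) (@dfa_start S A) s.

Lemma accept_cut (S : finType) (A : dfa S) i j (s : seq S) :
  run A (take i s) = run A (take j s) ->
  dfa_accept A (cut i j s) = dfa_accept A s.
Proof.
rewrite /run => eq_ij; rewrite /dfa_accept -[in RHS](cat_take_drop j s).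
by rewrite /cut !foldl_cat eq_ij.
Qed.

Lemma pigeonhole_seq (X : finType) (st : nat -> X) b :
  exists i j, [/\ b <= i, i < j, j <= b + #|X| & st i = st j].
Proof.
pose h (k : 'I_(#|X|.+1)) := st (b + k).
have /injectivePn [k1 [k2 k12 hk]] : ~~ injectiveb h.
  by apply/negP => /injectiveP /leq_card; rewrite card_ord ltnn.
have l1 := ltn_ord k1; have l2 := ltn_ord k2.
case: (ltngtP k1 k2) => lt.
- by exists (b + k1), (b + k2); split => //; lia.
- by exists (b + k2), (b + k1); split => //; lia.
- by move/val_inj: lt k12 => ->; rewrite eqxx.
Qed.

(** The only use of automaticity: [len] is the length of the representing string. Cutting accepted
    convolutions yields the first three properties, counting strings the last. *)
Lemma automatic_length (G : groupType) : word_automatic G ->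
  exists (len : G -> nat) (c q : nat),
  [/\ forall x y m, len x <= m -> len y <= m -> len (x * y)%g <= m + c,
      forall x m, len x <= m -> len x^-1%g <= m + c,
      forall x0, exists K, forall n, (exists g, n < len [~ g, x0]%g) ->
        exists g, n < len [~ g, x0]%g /\ len g <= n + K
    & forall (T : finType) (h : T -> G) m, injective h ->
        (forall t, len (h t) <= m) -> #|T| <= 2 ^ (q * m)].
Proof.
case=> S [D [f [_ [fD f_inj f_surj] [A relA]]]].
have /choice [r rP] : forall g : G, exists u, D u /\ f u = g.
  by move=> g; have [u Du <-] := f_surj g I; exists u.
have rD g : D (r g) by case: (rP g).
have rK g : f (r g) = g by case: (rP g).
have fK u : D u -> r (f u) = u.
  by move=> Du; apply: f_inj; rewrite ?rK ?inE.
pose Rel u v w := [/\ D u, D v, D w & (f u * f v)%g = f w].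
have relr g h : Rel (r g) (r h) (r (g * h)%g) by split; rewrite ?rK.
(* Triples of states, since three convolutions are cut at the same positions. *)
pose X := dfa_state A; pose N := #|{: X * X * X}|.
pose mx (t : seq S * seq S * seq S) :=
  maxn (size t.1.1) (maxn (size t.1.2) (size t.2)).
have relt i j t : Rel t.1.1 t.1.2 t.2 -> i <= j -> j <= mx t ->
    run A (take i (conv3 t.1.1 t.1.2 t.2)) =
      run A (take j (conv3 t.1.1 t.1.2 t.2)) ->
    Rel (cut i j t.1.1) (cut i j t.1.2) (cut i j t.2).
  case: t => -[u v] w /= /relA acc ij jm eq_run; apply/relA.
  by rewrite conv3_cut // accept_cut.
have pump b t1 t2 t3 :
    Rel t1.1.1 t1.1.2 t1.2 -> Rel t2.1.1 t2.1.2 t2.2 ->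
    Rel t3.1.1 t3.1.2 t3.2 ->
    b + N <= mx t1 -> b + N <= mx t2 -> b + N <= mx t3 ->
    exists i j, [/\ b <= i, i < j, j <= b + N &
      [/\ Rel (cut i j t1.1.1) (cut i j t1.1.2) (cut i j t1.2),
          Rel (cut i j t2.1.1) (cut i j t2.1.2) (cut i j t2.2) &
          Rel (cut i j t3.1.1) (cut i j t3.1.2) (cut i j t3.2)]].
  move=> R1 R2 R3 m1 m2 m3.
  pose st t k := run A (take k (conv3 t.1.1 t.1.2 t.2)).
  have [i [j [bi ij jb [e1 e2 e3]]]] :=
    pigeonhole_seq (fun k => (st t1 k, st t2 k, st t3 k)) b.
  exists i, j; split => //.
  by split; apply: relt => //; rewrite -/N in jb; lia.
have pump1 b u v w : Rel u v w -> b + N <= mx (u, v, w) ->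
    exists i j, [/\ b <= i, i < j, j <= b + N &
      Rel (cut i j u) (cut i j v) (cut i j w)].
  move=> R0 m0.
  have [i [j [bi ij jb [R1 _ _]]]] :=
    @pump b (u, v, w) (u, v, w) (u, v, w) R0 R0 R0 m0 m0 m0.
  by exists i, j.
pose len g := size (r g).
have lenM x y m : len x <= m -> len y <= m -> len (x * y)%g <= m + N.
  (* A cut beyond [m] fixes the strings of [x] and [y] but shortens that of [x * y], which
     contradicts uniqueness of strings. *)
  move=> xm ym; rewrite leqNgt; apply/negP => lt.
  have [|i [j [bi ij jb]]] := @pump1 m _ _ _ (relr x y).
    by rewrite /mx /= -/(len _) -/(len _) -/(len _); lia.
  rewrite !(@cut_id _ i j (r x), @cut_id _ i j (r y)); rewrite /len in xm ym; try lia.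
  case=> _ _ Dw; rewrite !rK => eqw; have := fK _ Dw; rewrite -eqw => /(congr1 size).
  by rewrite size_cut -/(len _); lia.
have lenV x m : len x <= m -> len x^-1%g <= m + (len 1%g + N).
  move=> xm; rewrite leqNgt; apply/negP => lt.
  have := relr x x^-1%g; rewrite mulgV => R0.
  (* The string of [1] must survive the cut as well, hence the summand [len 1]. *)
  have [|i [j [bi ij jb]]] := @pump1 (m + len 1%g) _ _ _ R0.
    by rewrite /mx /= -/(len _) -/(len _) -/(len _); lia.
  rewrite !(@cut_id _ i j (r x), @cut_id _ i j (r 1%g));
    rewrite /len in xm bi jb lt; try lia.
  case=> _ Dw _; rewrite !rK => /(canRL (mulKg _)); rewrite mulg1 => eqw.
  have := fK _ Dw; rewrite eqw => /(congr1 size).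
  by rewrite size_cut; lia.
exists len, (len 1%g + N), #|S|; split => //.
- by move=> x y m xm ym; apply: leq_trans (lenM _ _ _ xm ym) _; lia.
- (* A too long [g] is shortened by cutting the strings of [g], [g * x0],
     [x0 * g] and [[~ g, x0]] at the same two positions, chosen beyond [n] so
     that the last string stays longer than [n]. *)
  move=> x0; pose c0 := len x0 + len x0^-1%g.
  exists (c0 + N + N).+1 => n [g0 g0n].
  move: {2}(len g0) (leqnn (len g0)) g0n => l; elim: l g0 => [|l IH] g gl gn.
    by exists g; split => //; lia.
  have [?|lt] := leqP (len g) (n + (c0 + N + N).+1); first by exists g.
  (* Forces [g * x0] to be long, so that the third convolution can be cut as well; this costs the
     second [N] in the constant. *)
  have gx : len g <= maxn (len (g * x0)%g) (len x0^-1%g) + N.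
    by rewrite -{1}(mulgK x0 g); apply: lenM; rewrite leq_max leqnn ?orbT.
  have R3 : Rel (r (x0 * g)%g) (r [~ g, x0]%g) (r (g * x0)%g).
    by rewrite (commgC g x0); apply: relr.
  have [|||i [j [bi ij jb /= [R1' R2' R3']]]] :=
    @pump (n.+1 + c0) (_, _, _) (_, _, _) (_, _, _)
      (relr g x0) (relr x0 g) R3;
    rewrite /mx /= -?/(len _); try lia.
  move: R1' R2' R3'; rewrite (@cut_id _ i j (r x0)); try (rewrite -/(len _); lia).
  case=> Dg _ _; rewrite rK => e1 [_ _ _]; rewrite rK => e2 [_ Dw _].
  (* Cancelling [x0 * f (cut i j (r g))] shows that the cut string of the commutator represents the
     commutator of the shortened element. *)
  rewrite -e1 -e2 [X in _ = X]commgC => /mulgI e3.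
  apply: (IH (f (cut i j (r g)))).
    by rewrite /len fK // size_cut -/(len _); lia.
  by rewrite -e3 /len fK // size_cut -/(len _); lia.
- (* Strings of length at most [m] are padded to length [m] over [option S],
     and [#|option S| <= 2 ^ #|S|]. *)
  move=> T h m h_inj hm.
  have szh t : size (pad m (r (h t))) == m by rewrite size_pad //; apply: hm.
  pose e t : m.-tuple (option S) := Tuple (szh t).
  have e_inj : injective e.
    move=> t t' /(congr1 val) /= /(congr1 (nth None)) eq_pad.
    apply: h_inj; rewrite -[LHS]rK -[RHS]rK; congr f.
    have eq_onth k : onth (r (h t)) k = onth (r (h t')) k.
      by rewrite -!(nth_pad m) eq_pad.
    by apply: eq_from_onth.
  have := leq_card _ e_inj; rewrite card_tuple card_option => /leq_trans; apply.
  rewrite expnM; have [->|m_gt0] := posnP m; first by rewrite !expn0.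
  by rewrite leq_exp2r // ltn_expl.
Qed.

(** * Groups given by a presentation, and a class-2 model *)

Section Presentation.
Variables (T : choiceType) (R : set (word T)) (H : groupType) (h : T -> H).

Definition letter_eval (a : T * bool) : H :=
  if a.2 then (h a.1)^-1%g else h a.1.

Definition word_eval (w : word T) : H := (\prod_(a <- w) letter_eval a)%g.

Lemma word_eval_cat u v : word_eval (u ++ v) = (word_eval u * word_eval v)%g.
Proof. exact: big_cat. Qed.

Lemma word_eval_inv u : word_eval (inv_word u) = (word_eval u)^-1%g.
Proof.
rewrite /word_eval /inv_word; elim: u => [|[t b] u IH].
  by rewrite big_nil invg1.
rewrite /= rev_cons -cats1 big_cat /= IH big_seq1 big_cons invgM.
by congr (_ * _)%g; case: b; rewrite /letter_eval /= ?invgK.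
Qed.

Lemma word_eval_comm u v :
  word_eval (comm_word u v) = [~ word_eval u, word_eval v]%g.
Proof. by rewrite /comm_word !word_eval_cat !word_eval_inv. Qed.

Hypothesis hR : forall w, R w -> word_eval w = 1%g.

Lemma pres_word_eval u v : pres_eq R u v -> word_eval u = word_eval v.
Proof.
elim=> //.
- by move=> x y z _ -> _ ->.
- by move=> x x' y y' _ e1 _ e2; rewrite !word_eval_cat e1 e2.
- move=> [t b]; rewrite /word_eval big_cons big_seq1 big_nil.
  by case: b; rewrite /letter_eval /= ?mulgV ?mulVg.
- by move=> r /hR ->; rewrite /word_eval big_nil.
Qed.

(** Von Dyck's homomorphism, evaluated on chosen representatives. *)
Definition pres_lift (x : presented R) : H := word_eval (repr x).

Lemma pres_lift_pi w : pres_lift (\pi_(presented R) w)%qT = word_eval w.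
Proof. by apply/pres_word_eval/pres_repr. Qed.

Lemma pres_liftM x y : pres_lift (x * y)%g = (pres_lift x * pres_lift y)%g.
Proof.
rewrite -{1}[x]reprK -{1}[y]reprK.
have <- : (\pi_(presented R) (repr x ++ repr y))%qT =
   (\pi_(presented R) (repr x) * \pi_(presented R) (repr y))%qT%g.
  exact: pi_pres_mul.
by rewrite pres_lift_pi word_eval_cat.
Qed.

End Presentation.

Section Bilinear.
Variable F : comNzRingType.

(* The central extension of [F^nat] by the infinite matrices over [F] with
   cocycle the tensor product [v (x) w]; commutators are the alternating
   matrices [v (x) w - w (x) v]. *)
Definition nil2 : Type := ((nat -> F) * (nat -> nat -> F))%type.

Definition nil2_mul (x y : nil2) : nil2 :=
  (fun i => x.1 i + y.1 i, fun i j => x.2 i j + y.2 i j + x.1 i * y.1 j)%R.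

Definition nil2_one : nil2 := (fun=> 0, fun=> fun=> 0)%R.

Definition nil2_inv (x : nil2) : nil2 :=
  (fun i => - x.1 i, fun i j => x.1 i * x.1 j - x.2 i j)%R.

Lemma nil2P (x y : nil2) :
  (forall i, x.1 i = y.1 i) -> (forall i j, x.2 i j = y.2 i j) -> x = y.
Proof.
case: x y => v M [v' M'] /= ev eM; congr (_, _); apply/funext => // i.
by apply/funext.
Qed.

Fact nil2_mulA : associative nil2_mul.
Proof. by move=> x y z; apply: nil2P => [i|i j] /=; ring. Qed.

Fact nil2_mul1g : left_id nil2_one nil2_mul.
Proof. by move=> x; apply: nil2P => [i|i j] /=; ring. Qed.

Fact nil2_mulg1 : right_id nil2_one nil2_mul.
Proof. by move=> x; apply: nil2P => [i|i j] /=; ring. Qed.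

Fact nil2_mulVg : left_inverse nil2_one nil2_inv nil2_mul.
Proof. by move=> x; apply: nil2P => [i|i j] /=; ring. Qed.

Fact nil2_mulgV : right_inverse nil2_one nil2_inv nil2_mul.
Proof. by move=> x; apply: nil2P => [i|i j] /=; ring. Qed.

HB.instance Definition _ := gen_eqMixin nil2.
HB.instance Definition _ := gen_choiceMixin nil2.
HB.instance Definition _ := isGroup.Build nil2
  nil2_mulA nil2_mul1g nil2_mulg1 nil2_mulVg nil2_mulgV.

Lemma nil2_comm (x y : nil2) :
  [~ x, y]%g = (fun=> 0, fun i j => x.1 i * y.1 j - y.1 i * x.1 j)%R.
Proof. by apply: nil2P => [i|i j] /=; ring. Qed.

Lemma nil2_exp (x : nil2) n :
  (x ^+ n)%g = (fun i => x.1 i *+ n,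
                fun i j => x.2 i j *+ n + (x.1 i * x.1 j) *+ 'C(n, 2))%R.
Proof.
elim: n => [|n IH]; first by apply: nil2P => [i|i j]; rewrite /= ?mulr0n ?addr0.
rewrite expgS IH; apply: nil2P => [i|i j] /=; first by rewrite mulrS.
by rewrite binS bin1 mulrnDr !mulrS -mulrnAr; ring.
Qed.

End Bilinear.

(** * The structure of [L p] *)

Definition central (G : groupType) (z : G) := forall x, commute z x.

Lemma commMgJ (G : groupType) (x y z : G) :
  [~ x * y, z]%g = ([~ x, z] ^ y * [~ y, z])%g.
Proof. by rewrite /commg /conjg !invgM !mulgA !mulgK. Qed.

Lemma centralM (G : groupType) (y z : G) :
  central y -> central z -> central (y * z)%g.
Proof. by move=> cy cz x; apply/commute_sym/commuteM; apply/commute_sym. Qed.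

Lemma centralV (G : groupType) (z : G) : central z -> central z^-1%g.
Proof. by move=> cz x; apply/commute_sym/commuteV/commute_sym. Qed.

Lemma central_commMg (G : groupType) (x y z : G) : central [~ x, z]%g ->
  [~ x * y, z]%g = ([~ x, z] * [~ y, z])%g.
Proof. by move=> cxz; rewrite commMgJ /conjg cxz mulKg. Qed.

Lemma central_commVg (G : groupType) (x z : G) : central [~ x, z]%g ->
  [~ x^-1, z]%g = [~ x, z]^-1%g.
Proof.
move=> cxz; have := central_commMg x^-1%g cxz.
by rewrite mulgV comm1g => /esym/mulg1_eq.
Qed.

Section FreeNil2.
Variable p : nat.

Definition gen_x (i : nat) : L p := (\pi_(L p) (Lx i))%qT.

Lemma pi_catE (u v : word L_gen) :
  (\pi_(L p) (u ++ v) = \pi_(L p) u * \pi_(L p) v)%qT%g.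
Proof. exact: pi_pres_mul. Qed.

Lemma pi_invE (u : word L_gen) : (\pi_(L p) (inv_word u) = (\pi_(L p) u)^-1)%qT%g.
Proof. exact: pi_pres_inv. Qed.

Lemma pi_nilE : (\pi_(L p) [::] = 1)%qT%g.
Proof. by apply: (mulgI (\pi_(L p) [::])%qT); rewrite -pi_catE mulg1. Qed.

Lemma pi_relE (r : word L_gen) : L_relator p r -> (\pi_(L p) r = 1)%qT%g.
Proof. by move=> rr; rewrite -pi_nilE; apply/presentedP/pres_rel. Qed.

Lemma gen_x_exp i : (gen_x i ^+ p = 1)%g.
Proof.
have expE n : (\pi_(L p) (flatten (nseq n (Lx i))) = gen_x i ^+ n)%qT%g.
  by elim: n => [|n IH]; rewrite ?pi_nilE // expgS -IH -pi_catE.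
by rewrite -expE; apply/pi_relE/L_rel_exp.
Qed.

Lemma pi_LyE i k (lt_ik : i < k) :
  (\pi_(L p) (Ly lt_ik) = [~ gen_x i, gen_x k])%qT%g.
Proof.
have := pi_relE (L_rel_comm p lt_ik).
rewrite /comm_word !pi_catE !pi_invE -/(gen_x i) -/(gen_x k) => /divg1_eq <-.
by rewrite /commg /conjg !mulgA.
Qed.

(** Each [y_(i,k)] is a commutator of [x_i] and [x_k], so the [x_i] alone generate. *)
Lemma L_ind (P : L p -> Prop) : P 1%g ->
  (forall x y, P x -> P y -> P (x * y)%g) -> (forall x, P x -> P x^-1%g) ->
  (forall i, P (gen_x i)) -> forall g, P g.
Proof.
move=> P1 PM PV Px g; rewrite -[g]reprK; elim: (repr g) => [|a w IH].
  by rewrite pi_nilE.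
rewrite -cat1s pi_catE; apply: (PM) => //.
have Pt t : P (\pi_(L p) [:: (t, false)])%qT.
  case: t => [i|[[i k] lt_ik]]; first exact: Px.
  rewrite (pi_LyE lt_ik); apply: (PM); first exact/PV/Px.
  by apply: (PM); [exact/PV/Px | exact: PM].
case: a => t []; last exact: Pt.
by have := PV _ (Pt t); rewrite -pi_invE; apply.
Qed.

(** For [i < k] this commutator is a generator [y], which the relators make commute with every
    [x_r]. *)
Lemma gen_x_comm_central i k : central [~ gen_x i, gen_x k]%g.
Proof.
wlog lt_ik : i k / i < k => [IH|].
  case: (ltngtP i k) => [|lt_ki|->]; first exact: IH.
    by rewrite -invgR; apply/centralV/IH.
  by rewrite commgg => x; apply/commute_sym/commute1.
rewrite -pi_LyE; apply: L_ind => [|x y||r].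
- exact: commute1.
- exact: commuteM.
- by move=> x; apply: commuteV.
have := pi_relE (L_rel_central p lt_ik r).
rewrite /comm_word !pi_catE !pi_invE -/(gen_x r) => eq1.
by apply/commgP/eqP; rewrite -eq1 /commg /conjg !mulgA.
Qed.

Lemma comm_gen_x_central g k : central [~ g, gen_x k]%g.
Proof.
elim/L_ind: g => [|x y cx cy|x cx|i].
- by rewrite comm1g => x; apply/commute_sym/commute1.
- by rewrite central_commMg //; apply: centralM.
- by rewrite central_commVg //; apply: centralV.
- exact: gen_x_comm_central.
Qed.

Hypotheses (p_prime : prime p) (p_odd : odd p).

Let F := 'F_p.

Definition nil2_x (i : nat) : nil2 F := (fun j => (i == j)%:R, fun _ _ => 0)%R.

Definition nil2_gen (t : L_gen) : nil2 F :=
  match t with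
  | inl i => nil2_x i
  | inr ik => [~ nil2_x (sval ik).1, nil2_x (sval ik).2]%g
  end.

Lemma nil2_relator w : L_relator p w -> word_eval nil2_gen w = 1%g.
Proof.
have evalx i : word_eval nil2_gen (Lx i) = nil2_x i by exact: big_seq1.
have evaly i k (lt_ik : i < k) :
  word_eval nil2_gen (Ly lt_ik) = [~ nil2_x i, nil2_x k]%g by exact: big_seq1.
case=> [i|i k lt_ik|i k lt_ik r].
- have -> n : word_eval nil2_gen (flatten (nseq n (Lx i))) = (nil2_x i ^+ n)%g.
    elim: n => [|n IH]; first exact: big_nil.
    by rewrite expgS -IH -evalx -word_eval_cat.
  have p0 (a : F) n : p %| n -> (a *+ n = 0)%R.
    rewrite (dvdn_pcharf (pchar_Fp p_prime)) => /eqP n0.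
    by rewrite -mulr_natr n0 mulr0.
  rewrite nil2_exp; apply: nil2P => [j|j k] /=; rewrite !p0 ?addr0 //.
  (* Oddness gives [2 < p], so [p] divides ['C(p, 2)] and the cocycle term vanishes. *)
  by apply: prime_dvd_bin => //; case: p p_prime p_odd => [|[|[]]].
- by rewrite word_eval_cat word_eval_inv word_eval_comm !evalx evaly mulgV.
- rewrite word_eval_comm evalx evaly !nil2_comm; apply: nil2P => // j l /=.
  by ring.
Qed.

Definition nil2_hom : L p -> nil2 F :=
  @pres_lift L_gen (L_relator p) (nil2 F) nil2_gen.

Lemma nil2_homM x y : nil2_hom (x * y)%g = (nil2_hom x * nil2_hom y)%g.
Proof. exact: (pres_liftM nil2_relator). Qed.

Lemma nil2_hom1 : nil2_hom 1%g = 1%g.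
Proof. by apply: (mulgI (nil2_hom 1%g)); rewrite -nil2_homM !mulg1. Qed.

Lemma nil2_homV x : nil2_hom x^-1%g = (nil2_hom x)^-1%g.
Proof. by symmetry; apply: mulg1_eq; rewrite -nil2_homM mulgV nil2_hom1. Qed.

Lemma nil2_homX x n : nil2_hom (x ^+ n)%g = (nil2_hom x ^+ n)%g.
Proof.
by elim: n => [|n IH]; rewrite ?nil2_hom1 // !expgS nil2_homM IH.
Qed.

Lemma nil2_homR x y :
  nil2_hom [~ x, y]%g = [~ nil2_hom x, nil2_hom y]%g.
Proof. by rewrite /commg /conjg !nil2_homM !nil2_homV. Qed.

Lemma nil2_hom_x i : nil2_hom (gen_x i) = nil2_x i.
Proof. by rewrite [LHS](pres_lift_pi nil2_relator) [LHS]big_seq1. Qed.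

Lemma comm_gen_x_exp i k : ([~ gen_x i, gen_x k] ^+ p = 1)%g.
Proof.
have comX n : ([~ gen_x i ^+ n, gen_x k] = [~ gen_x i, gen_x k] ^+ n)%g.
  elim: n => [|n IH]; first by rewrite !expg0 comm1g.
  rewrite !expgS central_commMg ?IH //; exact: comm_gen_x_central.
by rewrite -comX gen_x_exp comm1g.
Qed.

(* The commutator with [x_0] is a homomorphism to the centre, killed by [p],
   hence determined by the exponent sums modulo [p]. *)
Lemma comm_gen_x0_prod g : exists (e : nat -> nat) (N0 : nat),
  (forall i, (e i)%:R%R = (nil2_hom g).1 i) /\
  (forall N, N0 <= N ->
    [~ g, gen_x 0] = \prod_(0 <= i < N) [~ gen_x i, gen_x 0] ^+ e i)%g.
Proof.
have com i j m n :
    commute ([~ gen_x i, gen_x 0] ^+ m)%g ([~ gen_x j, gen_x 0] ^+ n)%g.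
  by apply: commuteX2; apply: comm_gen_x_central.
elim/L_ind: g => [|g h [e [N0 [eg pg]]] [e' [N0' [eh ph]]]|g [e [N0 [eg pg]]]|i].
- exists (fun=> 0), 0; split=> [i|N _]; first by rewrite nil2_hom1.
  by rewrite comm1g big1.
- exists (fun i => e i + e' i), (maxn N0 N0'); split=> [i|N].
    by rewrite natrD eg eh nil2_homM.
  rewrite geq_max => /andP[N1 N2].
  rewrite central_commMg; last exact: comm_gen_x_central.
  rewrite (pg N) // (ph N) // -prodgM_commute; last by move=> *; apply: com.
  by apply: eq_bigr => i _; rewrite expgnDr.
(* [p.-1] is [-1] modulo [p]; this keeps the exponents natural numbers. *)
- exists (fun i => e i * p.-1), N0; split=> [i|N N1].
    rewrite natrM eg nil2_homV /=; have p1 : (p.-1%:R + 1 = 0 :> F)%R.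
      rewrite natr1 prednK ?prime_gt0 //.
      by apply/eqP; rewrite -(dvdn_pcharf (pchar_Fp p_prime)).
    by rewrite -[p.-1%:R%R](addrK 1%R) p1; ring.
  rewrite central_commVg; last exact: comm_gen_x_central.
  apply: mulg1_eq; rewrite (pg N) // -prodgM_commute; last by move=> *; apply: com.
  rewrite big1 // => i _; rewrite -expgnDr -mulnS prednK ?prime_gt0 //.
  by rewrite mulnC expgnA comm_gen_x_exp expg1n.
- exists (fun j => i == j : nat), i.+1; split=> [j|N iN].
    by rewrite nil2_hom_x.
  rewrite (@big_cat_nat _ _ _ i) ?(ltnW iN) //= (@big_ltn _ _ _ i) // eqxx expg1.
  by rewrite !big_nat !big1 ?mul1g ?mulg1 // => j /andP[ij ji];
    case: eqP => // eq_ij; move: ij ji; rewrite eq_ij ltnn.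
Qed.

(** Passes from the model back to [L p]: all exponents with [i > 0] are multiples of [p], and the
    factor with [i = 0] is a power of [[x_0, x_0] = 1]. *)
Lemma comm_gen_x0_eq1 g :
  (forall i, 0 < i -> (nil2_hom g).1 i = 0%R) -> [~ g, gen_x 0]%g = 1%g.
Proof.
move=> g0; have [e [N0 [eg /(_ _ (leqnn _)) ->]]] := comm_gen_x0_prod g.
apply: big1 => -[|i] _; first by rewrite commgg expg1n.
have /dvdnP[k ->] : p %| e i.+1.
  by rewrite (dvdn_pcharf (pchar_Fp p_prime)) eg g0.
by rewrite mulnC expgnA comm_gen_x_exp expg1n.
Qed.

End FreeNil2.

(** * Growth *)

Lemma nil2_prod1 (F : comNzRingType) (I : Type) (s : seq I) (x : I -> nil2 F) j :
  ((\prod_(i <- s) x i)%g.1 j = \sum_(i <- s) (x i).1 j)%R.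
Proof. by elim: s => [|i s IH]; rewrite ?big_nil // !big_cons /= IH. Qed.

Lemma nil2_prod2 (F : comNzRingType) (I : Type) (s : seq I) (x : I -> nil2 F) j k :
  (forall i l, (x i).1 l = 0)%R ->
  ((\prod_(i <- s) x i)%g.2 j k = \sum_(i <- s) (x i).2 j k)%R.
Proof.
move=> x0; elim: s => [|i s IH]; rewrite ?big_nil // !big_cons /= IH x0.
by rewrite mul0r addr0.
Qed.

(** Back substitution from the last index: in column [i], triangularity removes the terms before [i]
    and induction those after. *)
Lemma triangular_sum_eq0 (F : idomainType) d (T : 'I_d -> 'I_d -> F)
    (c : 'I_d -> F) :
  (forall i, T i i != 0%R) -> (forall i j : 'I_d, i < j -> T i j = 0%R) ->
  (forall j, \sum_i c i * T i j = 0)%R -> forall i, c i = 0%R.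
Proof.
move=> Tii Tij sum0 i; have [n] := ubnP (d - i); elim: n i => // n IH i lt_n.
have := sum0 i; rewrite (bigD1 i) //= big1 ?addr0 => [/eqP|j ji].
  by rewrite mulf_eq0 (negbTE (Tii i)) orbF => /eqP.
case: (ltngtP j i) => [lt|lt|/val_inj eq_ji].
- by rewrite Tij ?mulr0.
- by rewrite IH ?mul0r //; have := ltn_ord j; lia.
- by rewrite eq_ji eqxx in ji.
Qed.

(** * How lengths grow under commutators, products and powers *)

Section Length.
Variables (G : groupType) (len : G -> nat) (c : nat).
Hypothesis lenM : forall x y m,
  len x <= m -> len y <= m -> len (x * y)%g <= m + c.
Hypothesis lenV : forall x m, len x <= m -> len x^-1%g <= m + c.

Lemma len_comm x y m : len x <= m -> len y <= m -> len [~ x, y]%g <= m + 3 * c.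
Proof.
move=> xm ym; have xV := lenV xm; have yV := lenV ym; have xy := lenM xm ym.
have yxy := lenM yV xy.
have -> : m + 3 * c = (m + c + c) + c by lia.
by apply: lenM yxy; lia.
Qed.

(** Multiplying in one factor at a time costs [c] per factor rather than [m], as the new factor
    never exceeds the running bound. *)
Lemma len_prod (I : Type) (s : seq I) (x : I -> G) m :
  len 1%g <= m -> (forall i, len (x i) <= m) ->
  len (\prod_(i <- s) x i)%g <= m + c * size s.
Proof.
move=> m1 mx; elim: s => [|i s IH]; first by rewrite big_nil /=; lia.
rewrite big_cons /=.
have -> : m + c * (size s).+1 = m + c * size s + c by lia.
by apply: lenM => //; have := mx i; lia.
Qed.

Lemma len_exp x n m : len x <= m -> len 1%g <= m -> len (x ^+ n)%g <= m + c * n.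
Proof.
move=> xm m1; have := @len_prod _ (nseq n tt) (fun=> x) m m1 (fun=> xm).
by rewrite size_nseq big_nseq iter_mulg_1.
Qed.

End Length.

(** * Echelon sequences and the products of commutators built from them *)

Section Growth.
Variables (p : nat) (p_prime : prime p) (p_odd : odd p).
Local Notation F := 'F_p.
Local Notation x0 := (gen_x p 0).

Definition vec (g : L p) (i : nat) : F := (nil2_hom g).1 i.

Lemma vecM x y i : (vec (x * y)%g i = vec x i + vec y i)%R.
Proof. by rewrite /vec nil2_homM. Qed.

Lemma vecV x i : (vec x^-1%g i = - vec x i)%R.
Proof. by rewrite /vec nil2_homV. Qed.

Lemma vecX x n i : (vec (x ^+ n)%g i = vec x i *+ n)%R.
Proof. by rewrite /vec nil2_homX // nil2_exp. Qed.

Lemma nil2_hom_prod (I : Type) (s : seq I) (x : I -> L p) :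
  nil2_hom (\prod_(i <- s) x i)%g = (\prod_(i <- s) nil2_hom (x i))%g.
Proof. by apply: big_morph; [exact: nil2_homM | exact: nil2_hom1]. Qed.

(* Each pair consists of an element and its pivot coordinate; the element
   selected last is at the head of the list. *)
Definition echelon (gs : seq (L p * nat)) : bool :=
  pairwise (fun x y => vec x.1 y.2 == 0%R) gs &&
  all (fun x => vec x.1 x.2 != 0%R) gs.

(** Ordered products with exponents below [p] instead of the generated subgroup, so that lengths
    stay bounded. *)
Fixpoint span (gs : seq (L p * nat)) (s : L p) : Prop :=
  if gs is g :: gs' then
    exists t a, [/\ span gs' t, a < p & s = (t * g.1 ^+ a)%g]
  else s = 1%g.

Lemma span_echelon gs (w : nat -> F) : echelon gs ->
  exists s, span gs s /\ forall x, x \in gs -> vec s x.2 = w x.2.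
Proof.
elim: gs => [|[g r] gs IH]; first by exists 1%g.
rewrite /echelon /= -andbA => /and4P[/allP /= gr0 pgs gr ags].
have [|t [ts tw]] := IH; first exact/andP.
(* Corrects the pivot [r] only: [g] vanishes at the earlier pivots, where [t] is already right. *)
pose b : F := ((w r - vec t r) / vec g r)%R.
exists (t * g ^+ b)%g; split.
  exists t, b; split => //; rewrite -[X in _ < X](Fp_cast p_prime).
  exact: ltn_ord.
have bE i : (vec g i *+ b = vec g i * b)%R by rewrite -mulr_natr natr_Zp.
move=> x; rewrite inE vecM vecX bE => /orP[/eqP -> /=|xgs].
  by rewrite /b mulrC divfK // addrC subrK.
by rewrite (eqP (gr0 x xgs)) mul0r addr0 tw.
Qed.

Variables (len : L p -> nat) (c K : nat).
Hypothesis lenM : forall x y m,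
  len x <= m -> len y <= m -> len (x * y)%g <= m + c.
Hypothesis lenV : forall x m, len x <= m -> len x^-1%g <= m + c.
Hypothesis len_pump : forall n,
  exists g, n < len [~ g, x0]%g /\ len g <= n + K.

Lemma echelon_step gs m : len 1%g <= m -> len x0 <= m -> echelon gs ->
  (forall s, span gs s -> len s <= m) ->
  exists x, [/\ echelon (x :: gs), len x.1 <= m + (K + c * (6 + p))
    & forall s, span (x :: gs) s -> len s <= m + (K + c * (6 + p))].
Proof.
move=> m1 mx0 ech spm.
(* [m + 3 * c] bounds the length of [[~ s, x0]] for every [s] in the span. *)
have [g0 [long short]] := len_pump (m + 3 * c).
have [s [ss sw]] := span_echelon (vec g0) ech.
have sm := spm _ ss.
pose g := (g0 * s^-1)%g.
have gm : len g <= m + 3 * c + K + c + c.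
  apply: lenM; first by lia.
  by have := lenV sm; lia.
have [r gr] : exists r, vec g r != 0%R.
  (* Otherwise [g] commutes with [x0], so [[~ g0, x0]] equals [[~ s, x0]] and is too short. *)
  apply: contrapT => /forallNP gr.
  have /eqP/commgP comg : [~ g, x0]%g = 1%g.
    by apply: comm_gen_x0_eq1 => // i _; apply/eqP/negPn/negP/gr.
  have eqc : [~ g0, x0]%g = [~ s, x0]%g.
    rewrite -(mulgVK s g0) -/g commMgJ.
    by move/commgP/eqP: comg => ->; rewrite conj1g mul1g.
  by have := len_comm lenM lenV sm mx0; rewrite -eqc; lia.
exists (g, r); split.
- move: ech; rewrite /echelon /= gr => /andP[-> ->]; rewrite !andbT.
  by apply/allP => x xgs; rewrite vecM vecV sw // subrr.
- by rewrite /=; lia.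
- move=> _ [t [a [tsp ap ->]]].
  have gX := @len_exp _ _ _ lenM g a _ gm; have tm := spm _ tsp.
  (* Of the [6 + p] copies of [c], three come from the threshold, two from dividing by [s], [p] from
     the power and one from the last product. *)
  have -> : m + (K + c * (6 + p)) = (m + 3 * c + K + c + c + c * p) + c by lia.
  apply: lenM; first by lia.
  by apply: leq_trans (gX _) _; [lia | rewrite leq_add2l leq_mul2l ltnW ?orbT].
Qed.

Lemma echelon_exists k : exists gs, [/\ size gs = k, echelon gs
  & forall x, x \in gs ->
    len x.1 <= len 1%g + len x0 + (K + c * (6 + p)) * k].
Proof.
have := echelon_step; set L0 := _ + len x0; move: (K + _) => C step.
(* The bound on the span is carried along because the step consumes it. *)
have [gs [sz ech lgs _]] : exists gs, [/\ size gs = k, echelon gs,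
    forall x, x \in gs -> len x.1 <= L0 + C * k &
    forall s, span gs s -> len s <= L0 + C * k].
  elim: k => [|k [gs [sz ech lgs spm]]].
    by exists [::]; split => // s /= ->; rewrite /L0; lia.
  have [||x [ech' lx spx]] := step _ _ _ _ ech spm.
  - by rewrite /L0; lia.
  - by rewrite /L0; lia.
  have eqC : L0 + C * k + C = L0 + C * k.+1 by rewrite mulnS; lia.
  exists (x :: gs); split; rewrite /= ?sz //.
    move=> y; rewrite inE => /orP[/eqP ->|/lgs]; first by rewrite -eqC.
    by rewrite -eqC => /leq_trans; apply; apply: leq_addr.
  by move=> s /spx; rewrite eqC.
by exists gs.
Qed.

(** All [h k] vanish at the coordinates [r i], so in these rows only one half of the alternating
    commutator matrix remains; triangularity in [g] and then in [h] recovers [a]. *)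
Lemma comm_prod_inj d (g h : 'I_d -> L p) (r u : 'I_d -> nat) :
  (forall i, vec (g i) (r i) != 0%R) ->
  (forall i j : 'I_d, i < j -> vec (g i) (r j) = 0%R) ->
  (forall i, vec (h i) (u i) != 0%R) ->
  (forall i j : 'I_d, i < j -> vec (h i) (u j) = 0%R) ->
  (forall i j, vec (h i) (r j) = 0%R) ->
  injective (fun a : {ffun 'I_d * 'I_d -> bool} =>
    \prod_(k <- enum 'I_d) [~ \prod_(i <- enum 'I_d) g i ^+ a (i, k), h k])%g.
Proof.
move=> gr0 gr hu0 hu hr.
pose A (a : {ffun 'I_d * 'I_d -> bool}) i k : F := ((a (i, k))%:R)%R.
have vec_in (a : {ffun 'I_d * 'I_d -> bool}) k j :
    (vec (\prod_(i <- enum 'I_d) g i ^+ a (i, k))%g j =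
    \sum_i A a i k * vec (g i) j)%R.
  rewrite /vec nil2_hom_prod nil2_prod1 big_enum; apply: eq_bigr => i _.
  by rewrite -/(vec _ _) vecX -mulr_natl.
have M_out (a : {ffun 'I_d * 'I_d -> bool}) i0 j : ((nil2_hom (\prod_(k <- enum 'I_d)
      [~ \prod_(i <- enum 'I_d) g i ^+ a (i, k), h k])%g).2 (r i0) j =
    \sum_i (\sum_k A a i k * vec (h k) j) * vec (g i) (r i0))%R.
  rewrite nil2_hom_prod nil2_prod2 => [|k l]; last by rewrite nil2_homR // nil2_comm.
  under [RHS]eq_bigr => i _ do rewrite mulr_suml.
  rewrite exchange_big big_enum; apply: eq_bigr => k _.
  rewrite nil2_homR // nil2_comm /= -!/(vec _ _) hr mul0r subr0 vec_in mulr_suml.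
  by apply: eq_bigr => i _; rewrite mulrAC.
move=> a a' eq_aa'; apply/ffunP => -[i k].
have inner j : (\sum_k (A a i k - A a' i k) * vec (h k) j = 0)%R.
  have := @triangular_sum_eq0 _ d (fun i i0 => vec (g i) (r i0))
    (fun i => \sum_k (A a i k - A a' i k) * vec (h k) j)%R gr0 gr.
  apply => i0; have := M_out a i0 j; rewrite eq_aa' M_out => /eqP.
  rewrite -subr_eq0 -sumrB => /eqP eq0.
  rewrite -[RHS]oppr0 -[in RHS]eq0 -sumrN; apply: eq_bigr => l _.
  rewrite -mulrBl -mulNr -sumrB -sumrN; congr (_ * _)%R.
  by apply: eq_bigr => m _; ring.
have := triangular_sum_eq0 hu0 hu (fun j => inner (u j)) k.
by move/eqP; rewrite subr_eq0 /A; case: (a _) (a' _) => -[] //=;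
  rewrite ?(eq_sym 0%R) oner_eq0.
Qed.

End Growth.

Theorem mainTheorem1 (p : nat) (p_prime : prime p) (p_odd : odd p) :
  ~ word_automatic (L p).
Proof.
case/automatic_length => len [c [q [lenM lenV /(_ (gen_x p 0))[K pump] count]]].
have unbounded n : exists g, n < len [~ g, gen_x p 0]%g.
  apply: contrapT => /forallNP short.
  (* The [[x_(i+1), x_0]] are pairwise distinct, and this takes one more of them than the count
     allows. *)
  pose h (i : 'I_(2 ^ (q * n)).+1) := [~ gen_x p i.+1, gen_x p 0]%g.
  have h_inj : injective h.
    move=> i j eq_h; apply/val_inj/eqP.
    have : (nil2_hom (h i)).2 i.+1 0 = (nil2_hom (h j)).2 i.+1 0.
      by rewrite eq_h.
    rewrite !nil2_homR // !nil2_comm !nil2_hom_x //= !eqxx !mulr1 !mul0r !subr0.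
    by rewrite eqSS eq_sym; case: eqP => // _ /eqP; rewrite oner_eq0.
  suff /(count _ h n h_inj) : forall i, len (h i) <= n by rewrite card_ord ltnn.
  by move=> i; rewrite leqNgt; apply/negP/short.
have {unbounded}pump n := pump n (unbounded n).
pose C := K + c * (6 + p); pose L0 := len 1%g + len (gen_x p 0).
(* With this choice [q] times the length bound below is at most [(d - 1) * d < d * d]. *)
pose d := (q * (2 * C + 2 * c + (L0 + 3 * c))).+1.
have [gs [szgs]] := echelon_exists p_prime p_odd lenM lenV pump (d + d).
rewrite -/L0 -/C => /andP[/(pairwiseP (1%g, 0)) upper /allP diag] lgs.
pose x := nth (1%g, 0) gs.
have x_in i : i < d + d -> x i \in gs by move=> ?; apply: mem_nth; rewrite szgs.
have xd i : i < d + d -> vec (x i).1 (x i).2 != 0%R.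
  by move=> lt_i; apply/diag/x_in.
have xu i j : i < j -> j < d + d -> vec (x i).1 (x j).2 = 0%R.
  by move=> ij jd; apply/eqP/upper => //; rewrite inE szgs //; apply: ltn_trans jd.
(* The head of the list was selected last, so the first half vanishes at all pivots of the second
   half and serves as [h]. *)
have P_inj := @comm_prod_inj p p_prime p_odd d (fun i => (x (d + i)).1)
  (fun k => (x k).1) (fun i => (x (d + i)).2) (fun k => (x k).2).
set P := (X in injective X) in P_inj.
pose B := L0 + C * (d + d).
have B1 : len 1%g <= B by rewrite /B /L0; lia.
have lx i : i < d + d -> len (x i).1 <= B by move=> /x_in/lgs.
have lP a : len (P a) <= B + c * d + 3 * c + c * d.
  have -> : c * d = c * size (enum 'I_d) by rewrite size_enum_ord.
  apply: (len_prod lenM) => [|k]; first by lia.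
  apply: (len_comm lenM lenV).
    apply: (len_prod lenM) => // i; case: (a _); rewrite ?expg1 ?expg0 //.
    by apply: lx; rewrite ltn_add2l.
  by apply: leq_trans (lx _ _) _; [have := ltn_ord k; lia | apply: leq_addr].
suff /count/(_ lP) : injective P.
  rewrite card_ffun card_bool card_prod card_ord leq_exp2l // leqNgt => /negP.
  by apply; rewrite /B /d; nia.
apply: P_inj.
- by move=> i; apply: xd; rewrite ltn_add2l.
- by move=> i j ij; apply: xu; rewrite ltn_add2l.
- by move=> i; apply: xd; have := ltn_ord i; lia.
- by move=> i j ij; apply: xu => //; have := ltn_ord j; lia.
- by move=> i j; apply: xu; have := ltn_ord i; have := ltn_ord j; lia.
Qed.
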